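(* Let $p$ be an odd prime, $q\in\mathbb{C}_p$ with $|q-1|_p<1$, $h\in\mathbb{Z}$ and $\zeta\in T_p$. For every $n\in\mathbb{N}=\{1,2,\dots\}$, $$q^{2h}\zeta^2E^{(h)}_{n,q,\zeta}(2)=E^{(h)}_{n,q,\zeta}+\frac{1+q}{1+q^h\zeta}q^{2h}\zeta^2+\frac{1+q}{1+q^h\zeta}q^h\zeta .$$
   Context: $\mathbb{Z}_p$, $\mathbb{C}_p$ denote the $p$-adic integers and the completion of the algebraic closure of $\mathbb{Q}_p$. $T_p=\bigcup_{n\ge1}\{\zeta\in\mathbb{C}_p:\zeta^{p^n}=1\}$; for $\zeta\in T_p$ and $y\in\mathbb{Z}_p$, $\zeta^y$ is defined by continuity. $[x]_q=\frac{1-q^x}{1-q}$. For uniformly differentiable $f:\mathbb{Z}_p\to\mathbb{C}_p$, $\int_{\mathbb{Z}_p}f(x)\,d\mu_{-q}(x)=\lim_{N\to\infty}\frac{1+q}{1+q^{p^N}}\sum_{x=0}^{p^N-1}f(x)(-q)^x$. The twisted $(h,q)$-Euler polynomials are $E^{(h)}_{n,q,\zeta}(x)=\int_{\mathbb{Z}_p}[x+y]_q^n\zeta^y q^{(h-1)y}\,d\mu_{-q}(y)$ for $n\in\mathbb{Z}_+=\{0,1,2,\dots\}$, and $E^{(h)}_{n,q,\zeta}=E^{(h)}_{n,q,\zeta}(0)$. *)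

(* Defs.v *)
From HB Require Import structures.
From mathcomp Require Import all_boot all_order all_algebra.
From mathcomp Require Import all_classical all_reals topology.

Set Implicit Arguments.
Unset Strict Implicit.
Unset Printing Implicit Defensive.

Import Order.TTheory GRing.Theory Num.Theory.
Local Open Scope classical_set_scope.
Local Open Scope ring_scope.

(* A field with a multiplicative ultrametric absolute value, whose topology
   and uniform structure are the ones given by the distance |x - y|. *)
HB.mixin Record isUltrametricField (R : realType) K
    & GRing.Field K & PseudoMetric R K := {
  vabs : K -> R ;
  vabs_ge0 : forall x, 0 <= vabs x ;
  vabs_eq0 : forall x, vabs x = 0 -> x = 0 ;
  vabsM : forall x y, vabs (x * y) = vabs x * vabs y ;
  vabs_ultra : forall x y, vabs (x + y) <= Num.max (vabs x) (vabs y) ;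
  ball_vabs : forall (x : K) (e : R),
    ball x e = [set y | vabs (x - y) < e] }.

#[short(type="completeUltrametricFieldType")]
HB.structure Definition CompleteUltrametricField (R : realType) :=
  {K of GRing.Field K & CompletePseudoMetric R K & isUltrametricField R K}.

Section ClosureInField.
Context (R : realType) (K : completeUltrametricFieldType R).

(* When |p| = 1/p, the absolute value of K restricts to the p-adic one on Q;
   as K is complete, the closure of Q in K is then the completion Q_p. *)
Definition Qp : set K := closure (range (@ratr K)).

Definition poly_over (A : set K) (P : {poly K}) := forall i, A P`_i.

Definition Qp_alg : set K :=
  [set x | exists P : {poly K}, [/\ P != 0, poly_over Qp P & root P x]].

End ClosureInField.
Arguments Qp {R} K.
Arguments Qp_alg {R} K.

(* C_p, the completion of an algebraic closure of Q_p, given up to isometric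
   isomorphism: K is complete, and the elements of K algebraic over Q_p form an
   algebraically closed field (hence an algebraic closure of Q_p) dense in K. *)
HB.mixin Record isPadicComplex (R : realType) (p : nat) K
    & CompleteUltrametricField R K := {
  vabs_p : vabs (p%:R : K) = p%:R^-1 :> R ;
  Qp_alg_closed : forall P : {poly K}, poly_over (Qp_alg K) P ->
    (1 < size P)%N -> exists2 x, Qp_alg K x & root P x ;
  Qp_alg_dense : closure (Qp_alg K) = setT }.

#[short(type="padicComplexType")]
HB.structure Definition PadicComplex (R : realType) (p : nat) :=
  {K of CompleteUltrametricField R K & isPadicComplex R p K}.

Section PadicEuler.
Context (R : realType) (p : nat) (K : padicComplexType R p).
Implicit Types (a q zeta x y : K) (f : K -> K) (h : int) (n : nat).

Definition Zp : set K := closure (range (fun n : nat => n%:R)).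

Definition Tp : set K :=
  [set zeta | exists2 n, (1 <= n)%N & zeta ^+ (p ^ n) = 1].

(* a ^ y for y in Z_p, by continuity: the limit of a ^+ m as the natural
   number m tends p-adically to y (including m = y if y is natural). *)
Definition padic_pow a y : K :=
  lim ((fun m : nat => a ^+ m) @
       filter_from (nbhs y) (fun U => [set m : nat | U m%:R])).

(* [x]_q, continuously extended by [x]_1 = x. *)
Definition qnum q x : K :=
  if q == 1 then x else (1 - padic_pow q x) / (1 - q).

(* The integral of f over Z_p with respect to mu_{-q}; f is a function on Z_p,
   so only its values on Zp (in fact on the dense subset of naturals) matter. *)
Definition fermionic_integral q f : K :=
  lim ((fun N : nat => (1 + q) / (1 + q ^+ (p ^ N)) *
         \sum_(0 <= x < p ^ N) f x%:R * (- q) ^+ x) @ \oo).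

(* Twisted (h,q)-Euler polynomial, for x in Z_p; both powers below have an
   exponent in Z_p. *)
Definition Euler_poly h n q zeta x : K :=
  fermionic_integral q (fun y =>
    qnum q (x + y) ^+ n * padic_pow zeta y * padic_pow q ((h - 1)%:~R * y)).

Definition Euler_number h n q zeta : K := Euler_poly h n q zeta 0.

End PadicEuler.
Arguments Tp {R p} K.
Arguments Zp {R p} K.

(* Main.v *)
(** Write [a = q^h zeta]; [a^(p^N)] tends to 1.  The integrand at a natural
    number [y], multiplied by [(-q)^y], is [(-1)^y g(y)] with
    [g(y) = a^y [x+y]_q^n], and [g] is uniformly p-adically continuous; grouping
    the sum of length [p^(N+1)] in [p] blocks (an odd number) of alternating
    signs shows that the alternating sums of [g] are Cauchy, so that the integrals
    defining the Euler polynomials do converge.  Then [a^2] times the sum for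
    [x = 2] is the sum for [x = 0] with its index shifted by 2; the four boundary
    terms tend to [2a], and multiplying by [(1+q)/2], the limit of
    [(1+q)/(1+q^(p^N))], leaves [(1+q)a = (1+q)/(1+a) (a^2+a)]. *)

Require Import Defs.
From HB Require Import structures.
From mathcomp Require Import all_boot all_order all_algebra.
From mathcomp Require Import all_classical all_reals topology normedtype sequences.
From mathcomp Require Import zify ring lra.
Import Order.TTheory GRing.Theory Num.Theory.
Local Open Scope classical_set_scope.
Local Open Scope ring_scope.

Set Implicit Arguments.
Unset Strict Implicit.

(** * Ultrametric absolute values *)

Section UltrametricField.
Context {R : realType} {K : completeUltrametricFieldType R}.
Implicit Types (x y l : K) (e : R) (n : nat).

(* Multiplicativity alone allows [vabs 0 = 1] for the trivial absolute value;
   the pseudometric axiom [ball_center] excludes it. *)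
Lemma vabs0 : vabs (0 : K) = 0 :> R.
Proof.
apply/eqP; rewrite eq_le vabs_ge0 andbT; apply/ler_addgt0Pl => e e0.
rewrite addr0; have := ballxx (0 : K) e0.
by rewrite ball_vabs /= subrr => /ltW.
Qed.

Lemma vabs1 : vabs (1 : K) = 1 :> R.
Proof.
have n0 : vabs (1 : K) != 0 :> R.
  by apply/eqP => /vabs_eq0 /eqP; rewrite oner_eq0.
by apply: (mulfI n0); rewrite -vabsM !mulr1.
Qed.

Lemma vabsN x : vabs (- x) = vabs x :> R.
Proof.
suff -> : vabs (- x) = vabs (-1 : K) * vabs x :> R.
  suff -> : vabs (-1 : K) = 1 :> R by rewrite mul1r.
  apply/eqP; rewrite -(@eqrXn2 _ 2%N) ?vabs_ge0 // expr1n expr2 -vabsM.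
  by rewrite mulrNN mulr1 vabs1.
by rewrite -vabsM mulN1r.
Qed.

Lemma vabs_distC x y : vabs (x - y) = vabs (y - x) :> R.
Proof. by rewrite -vabsN opprB. Qed.

Lemma vabsX x n : vabs (x ^+ n) = vabs x ^+ n :> R.
Proof. by elim: n => [|n IH]; rewrite ?expr0 ?vabs1 // !exprS vabsM IH. Qed.

Lemma vabsV x : vabs x^-1 = (vabs x)^-1 :> R.
Proof.
have [->|x0] := eqVneq x 0; first by rewrite invr0 vabs0 invr0.
have v0 : vabs x != 0 :> R by apply: contra_neq x0 => /vabs_eq0.
by apply: (mulfI v0); rewrite divff // -vabsM divff // vabs1.
Qed.

Lemma vabsD_lt x y e : vabs x < e -> vabs y < e -> vabs (x + y) < e.
Proof.
by move=> xe ye; apply: le_lt_trans (vabs_ultra x y) _; rewrite gt_max xe.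
Qed.

Lemma vabsB_lt x y e : vabs x < e -> vabs y < e -> vabs (x - y) < e.
Proof. by move=> xe ye; apply: vabsD_lt => //; rewrite vabsN. Qed.

Lemma vabsD_le x y e : vabs x <= e -> vabs y <= e -> vabs (x + y) <= e.
Proof.
by move=> xe ye; apply: le_trans (vabs_ultra x y) _; rewrite ge_max xe.
Qed.

Lemma vabs_sum_lt (I : Type) (r : seq I) (P : pred I) (F : I -> K) e :
  0 < e -> (forall i, P i -> vabs (F i) < e) ->
  vabs (\sum_(i <- r | P i) F i) < e.
Proof.
move=> e0 Fe; elim/big_ind: _ => [|x y|//]; first by rewrite vabs0.
exact: vabsD_lt.
Qed.

Lemma vabs_sum_le (I : Type) (r : seq I) (P : pred I) (F : I -> K) e :
  0 <= e -> (forall i, P i -> vabs (F i) <= e) ->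
  vabs (\sum_(i <- r | P i) F i) <= e.
Proof.
move=> e0 Fe; elim/big_ind: _ => [|x y|//]; first by rewrite vabs0.
exact: vabsD_le.
Qed.

Lemma vabs_nat_le1 n : vabs (n%:R : K) <= 1 :> R.
Proof.
elim: n => [|n IH]; first by rewrite vabs0.
by rewrite -natr1; apply: vabsD_le; rewrite ?vabs1.
Qed.

(** If [vabs x] were below 1, so would be that of [1 = x - (x - 1)]. *)
Lemma vabs_eq1 x : vabs (x - 1) < 1 :> R -> vabs x = 1 :> R.
Proof.
move=> x1; apply/eqP; rewrite eq_le; apply/andP; split.
  by rewrite -(subrK 1 x); apply: vabsD_le; rewrite ?vabs1 // ltW.
rewrite leNgt; apply/negP => xlt1.
have := vabsB_lt xlt1 x1.
by rewrite opprB addrC subrK vabs1 ltxx.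
Qed.

Lemma vabs_hausdorff : hausdorff_space K.
Proof.
move=> x y /= clxy; apply/eqP; rewrite -subr_eq0; apply/eqP.
apply: (@vabs_eq0 R K).
apply/eqP; rewrite eq_le vabs_ge0 andbT; apply/ler_addgt0Pl => e e0.
rewrite addr0.
have [z []] := clxy _ _ (nbhsx_ballx x e e0) (nbhsx_ballx y e e0).
rewrite !ball_vabs /= => xz yz.
by have /ltW := vabsB_lt xz yz; rewrite opprB addrA subrK.
Qed.

Lemma cvg_vabsP {T : Type} {F : set_system T} {FF : Filter F} (f : T -> K) l :
  f @ F --> l <->
  forall e, 0 < e -> \forall x \near F, vabs (f x - l) < e.
Proof.
split=> [/cvg_ballP fl e /fl|fl].
  by apply: filterS => x; rewrite ball_vabs /= vabs_distC.
apply/cvg_ballP => e /fl.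
by apply: filterS => x; rewrite ball_vabs /= vabs_distC.
Qed.

(** * Limits of sums, products and inverses *)

Section Limits.
Context {T : Type} {F : set_system T} {FF : Filter F}.
Implicit Types (f g : T -> K) (a b : K).

Lemma cvg_vabsD f g a b :
  f @ F --> a -> g @ F --> b -> (fun t => f t + g t) @ F --> a + b.
Proof.
move=> /cvg_vabsP fa /cvg_vabsP gb; apply/cvg_vabsP => e e0.
near=> t; rewrite opprD addrACA; apply: vabsD_lt; near: t; [exact: fa|exact: gb].
Unshelve. all: by end_near. Qed.

Lemma cvg_vabsM f g a b :
  f @ F --> a -> g @ F --> b -> (fun t => f t * g t) @ F --> a * b.
Proof.
move=> /cvg_vabsP fa /cvg_vabsP gb; apply/cvg_vabsP => e e0.
have M0 : 0 < 1 + vabs b + vabs a :> R.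
  by rewrite -addrA ltr_pwDl // addr_ge0 ?vabs_ge0.
(* As one error is below 1, the product of the errors is no larger than the other; the denominator
   covers this term and both cross terms. *)
have d0 : 0 < Num.min 1 (e / (1 + vabs b + vabs a)) by rewrite lt_min ltr01 divr_gt0.
near=> t.
have -> : f t * g t - a * b =
  (f t - a) * (g t - b) + ((f t - a) * b + a * (g t - b)) by ring.
have : vabs (f t - a) < Num.min 1 (e / (1 + vabs b + vabs a)) by near: t; exact: fa.
have : vabs (g t - b) < Num.min 1 (e / (1 + vabs b + vabs a)) by near: t; exact: gb.
rewrite !lt_min !ltr_pdivlMr // => /andP[g1 ge] /andP[f1 fe].
move: (vabs_ge0 (f t - a) : 0 <= _ :> R) (vabs_ge0 (g t - b) : 0 <= _ :> R).
move: (vabs_ge0 a : 0 <= _ :> R) (vabs_ge0 b : 0 <= _ :> R) => a0 b0 f0 g0.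
by apply: vabsD_lt; [|apply: vabsD_lt]; rewrite vabsM; nra.
Unshelve. all: by end_near. Qed.

Lemma cvg_vabsX f a n : f @ F --> a -> (fun t => f t ^+ n) @ F --> a ^+ n.
Proof.
move=> fa; elim: n => [|n IH]; first exact: cvg_cst.
by rewrite exprS; under eq_fun do rewrite exprS; exact: cvg_vabsM.
Qed.

Lemma cvg_vabsV f a : a != 0 -> f @ F --> a -> (fun t => (f t)^-1) @ F --> a^-1.
Proof.
move=> a0 /cvg_vabsP fa; apply/cvg_vabsP => e e0.
have va0 : 0 < vabs a :> R.
  by rewrite lt_def vabs_ge0 andbT; apply: contra_neq a0 => /vabs_eq0.
(* Closeness within [vabs a] forces [vabs (f t) = vabs a]; the factor [vabs a ^+ 2] then pays for
   the denominator [f t * a]. *)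
have d0 : 0 < Num.min (vabs a) (e * vabs a ^+ 2).
  by rewrite lt_min va0 mulr_gt0 // exprn_gt0.
near=> t.
have : vabs (f t - a) < Num.min (vabs a) (e * vabs a ^+ 2) by near: t; exact: fa.
rewrite lt_min => /andP[fa1 fae].
have fE : vabs (f t) = vabs a :> R.
  have -> : f t = a * (1 + (f t - a) / a) by field.
  rewrite vabsM [vabs (1 + _)]vabs_eq1 ?mulr1 // [1 + _]addrC addrK.
  by rewrite vabsM vabsV ltr_pdivrMr // mul1r.
have ft0 : f t != 0.
  by apply: contraTneq va0 => ft0; rewrite -fE ft0 vabs0 ltxx.
have -> : (f t)^-1 - a^-1 = - (f t - a) / (f t * a) by field; rewrite ft0 a0.
by rewrite vabsM vabsN vabsV vabsM fE -expr2 ltr_pdivrMr ?exprn_gt0.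
Unshelve. all: by end_near. Qed.

End Limits.

(** Any difference [u n - u N] is a sum of consecutive ones, hence bounded by their maximum, so the
    sequence is Cauchy. *)
Lemma vabs_cauchy_cvg (u : nat -> K) :
  (forall e, 0 < e -> \forall n \near \oo, vabs (u n.+1 - u n) < e) ->
  cvg (u @ \oo).
Proof.
move=> ucau; apply: cauchy_cvg; apply: cauchy_exP => e e0.
have [N _ uN] := ucau e e0; exists (u N); exists N => // n /= Nn.
rewrite ball_vabs /= vabs_distC.
elim: n Nn => [|n IH]; first by rewrite leqn0 => /eqP ->; rewrite subrr vabs0.
rewrite leq_eqVlt => /orP[/eqP <-|]; first by rewrite subrr vabs0.
rewrite ltnS => Nn; rewrite -(subrK (u n) (u n.+1)) -addrA.
by apply: vabsD_lt; [exact: uN|exact: IH].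
Qed.

End UltrametricField.

(** * Powers of a real number below 1 *)

Section RealPowers.
Import numFieldNormedType.Exports.

Lemma expr_eventually_lt (R : realType) (c e : R) : 0 <= c < 1 -> 0 < e ->
  \forall N \near \oo, c ^+ N < e.
Proof.
move=> /andP[c0 c1] e0.
have /cvg_expr/cvgr0Pnorm_lt/(_ e e0) : `|c| < 1 by rewrite ger0_norm.
by apply: filterS => N; apply: le_lt_trans; exact: ler_norm.
Qed.

End RealPowers.

(** * The absolute value on naturals, and powers with p-adic exponents *)

Section PadicPowers.
Context {R : realType} {p : nat} {K : padicComplexType R p}.
Hypothesis p_prime : prime p.
Implicit Types (a b q zeta x : K) (e : R) (h : int) (k n m d N : nat).

Lemma vabs_pX N : vabs ((p ^ N)%:R : K) = p%:R^-1 ^+ N :> R.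
Proof. by rewrite natrX vabsX vabs_p. Qed.

Lemma invp_lt1 : p%:R^-1 < 1 :> R.
Proof.
by rewrite invf_lt1 ?ltr1n ?ltr0n ?prime_gt1 // prime_gt0.
Qed.

(** In a Bezout relation [1 = u p - v n] the term in [p] is small; were [n] small too, 1 would
    be. *)
Lemma vabs_coprime n : coprime p n -> vabs (n%:R : K) = 1 :> R.
Proof.
move=> /(coprimeP _ (prime_gt0 p_prime))[[u v] /= uv].
apply/eqP; rewrite eq_le vabs_nat_le1 /= leNgt; apply/negP => n1.
suff : vabs (1 : K) < 1 :> R by rewrite vabs1 ltxx.
have -> : 1 = u%:R * p%:R - v%:R * n%:R :> K.
  rewrite -!natrM -natrB ?uv //; lia.
apply: vabsB_lt; rewrite vabsM.
  apply: le_lt_trans invp_lt1; rewrite vabs_p -[leRHS]mul1r.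
  by rewrite ler_wpM2r ?invr_ge0 // vabs_nat_le1.
apply: le_lt_trans n1; rewrite -[leRHS]mul1r.
by rewrite ler_wpM2r ?vabs_ge0 // vabs_nat_le1.
Qed.

(** Splitting off the p-part [p ^ l] of [n] gives [vabs n = p^-l]. This turns closeness of exponents
    into divisibility. *)
Lemma vabs_lt_dvdn N n : vabs (n%:R : K) < p%:R^-1 ^+ N :> R -> (p ^ N %| n)%N.
Proof.
case: (posnP n) => [-> _|n0]; first exact: dvdn0.
have [m pm {1}->] := pfactor_coprime p_prime n0.
rewrite natrM vabsM vabs_coprime // mul1r vabs_pX => vN.
rewrite pfactor_dvdn // leqNgt; apply/negP => /ltnW lN; move: vN.
by rewrite ltNge => /negP; apply; rewrite ler_wiXn2l ?invr_ge0 // ltW ?invp_lt1.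
Qed.

Lemma vabs_dvdn_le N n : (p ^ N %| n)%N -> vabs (n%:R : K) <= p%:R^-1 ^+ N :> R.
Proof.
move=> /dvdnP[m ->]; rewrite natrM vabsM vabs_pX -[leRHS]mul1r.
by rewrite ler_wpM2r ?exprn_ge0 ?invr_ge0 // vabs_nat_le1.
Qed.

(* The condition under which [m |-> a ^ m] extends continuously to Z_p. *)
Definition pow_cvg1 a := (fun N => a ^+ (p ^ N)) @ \oo --> (1 : K).

Lemma pow_cvg1_vabs a : pow_cvg1 a -> vabs a = 1 :> R.
Proof.
move=> /cvg_vabsP/(_ 1 ltr01)[N _ /(_ N (leqnn N))] /vabs_eq1 /eqP.
rewrite vabsX -[X in _ == X -> _](expr1n R (p ^ N)).
by rewrite eqrXn2 ?expn_gt0 ?prime_gt0 ?vabs_ge0 // => /eqP.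
Qed.

Lemma pow_cvg1_neq0 a : pow_cvg1 a -> a != 0.
Proof.
move=> /pow_cvg1_vabs a1; apply/eqP => a0; move: a1.
by rewrite a0 vabs0 => /eqP; rewrite eq_sym oner_eq0.
Qed.

(** With [x = a ^+ (p ^ N)], the quotient of [x ^+ k - 1] by [x - 1] is a sum of elements of
    absolute value 1, so passing to multiples of [p ^ N] loses nothing. *)
Lemma pow_cvg1_dvdn a e : pow_cvg1 a -> 0 < e ->
  exists N, forall d, (p ^ N %| d)%N -> vabs (a ^+ d - 1) < e.
Proof.
move=> ca e0; have a1 := pow_cvg1_vabs ca.
have /cvg_vabsP/(_ e e0)[N _ /(_ N (leqnn N)) /= aN] := ca.
exists N => d /dvdnP[k ->]; rewrite mulnC exprM subrX1 vabsM.
apply: le_lt_trans aN; rewrite -[leRHS]mulr1.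
rewrite ler_wpM2l ?vabs_ge0 //; apply: vabs_sum_le => // i _.
by rewrite !vabsX a1 !expr1n.
Qed.

Lemma pow_cvg1M a b : pow_cvg1 a -> pow_cvg1 b -> pow_cvg1 (a * b).
Proof.
rewrite /pow_cvg1 => ca cb; rewrite -[X in _ --> X]mulr1.
under eq_fun do rewrite exprMn.
exact: cvg_vabsM.
Qed.

Lemma pow_cvg1V a : pow_cvg1 a -> pow_cvg1 a^-1.
Proof.
rewrite /pow_cvg1 => ca; rewrite -[X in _ --> X]invr1.
under eq_fun do rewrite exprVn.
by apply: cvg_vabsV => //; exact: oner_neq0.
Qed.

Lemma pow_cvg1X a n : pow_cvg1 a -> pow_cvg1 (a ^+ n).
Proof.
move=> ca; elim: n => [|n IH]; last by rewrite exprS; exact: pow_cvg1M.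
rewrite /pow_cvg1; under eq_fun do rewrite expr1n.
exact: cvg_cst.
Qed.

Lemma pow_cvg1Xz a h : pow_cvg1 a -> pow_cvg1 (a ^ h).
Proof.
case: h => n ca; first exact: pow_cvg1X.
exact: pow_cvg1V (pow_cvg1X n.+1 ca).
Qed.

(** Each p-th power shrinks the distance to 1 by a factor [c]: in
    [x ^+ p - 1 = (x - 1) * \sum x ^+ i], the sum is [p] plus terms [x ^+ i - 1], all bounded by
    [c]. *)
Lemma pow_cvg1_near1 q : vabs (q - 1) < 1 :> R -> pow_cvg1 q.
Proof.
move=> q1; pose c : R := Num.max (vabs (q - 1)) p%:R^-1.
have c0 : 0 <= c by rewrite le_max vabs_ge0.
have c1 : c < 1 by rewrite gt_max q1 invp_lt1.
have qN N : vabs (q ^+ (p ^ N) - 1) <= c ^+ N.+1.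
  elim: N => [|N IH]; first by rewrite expn0 !expr1 le_max lexx.
  set x := q ^+ (p ^ N) in IH *.
  have xc : vabs (x - 1) <= c.
    by apply: le_trans IH _; rewrite exprS ler_piMr // exprn_ile1 // ltW.
  have x1 : vabs x = 1 :> R by apply: vabs_eq1; exact: le_lt_trans xc c1.
  rewrite expnSr exprM subrX1 vabsM exprSr.
  rewrite ler_pM ?vabs_ge0 //.
  have -> : \sum_(i < p) x ^+ i = \sum_(i < p) (x ^+ i - 1) + p%:R.
    by rewrite big_split /= sumr_const card_ord mulNrn subrK.
  apply: vabsD_le; last by rewrite vabs_p le_max lexx orbT.
  apply: vabs_sum_le => // i _; rewrite subrX1 vabsM.
  rewrite -[leRHS]mulr1 ler_pM ?vabs_ge0 //.
  by apply: vabs_sum_le => // j _; rewrite vabsX x1 expr1n.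
apply/cvg_vabsP => e e0.
have /(expr_eventually_lt)/(_ e0) : 0 <= c < 1 by rewrite c0.
apply: filterS => N; apply: le_lt_trans; apply: le_trans (qN N) _.
by rewrite exprS ler_piMl ?exprn_ge0 // ltW.
Qed.

Lemma pow_cvg1_Tp zeta : Tp K zeta -> pow_cvg1 zeta.
Proof.
move=> [n _ zn]; apply/cvg_vabsP => e e0; exists n => // N /= nN.
by rewrite -(subnKC nN) expnD exprM zn expr1n subrr vabs0.
Qed.

(** Naturals [m] close to [h] differ from it by a multiple of a high power of [p], so [a ^+ m] is
    close to [a ^ h]. Negative [h] occur, through the exponents [(h - 1) * y]. *)
Lemma padic_pow_int a h : pow_cvg1 a -> padic_pow a h%:~R = a ^ h.
Proof.
move=> ca; rewrite /padic_pow.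
have F_filter : Filter (filter_from (nbhs (h%:~R : K))
    (fun U => [set m : nat | U m%:R])).
  apply: filter_from_filter; first by exists setT; exact: filterT.
  move=> U V hU hV; exists (U `&` V); first exact: filterI.
  by move=> m [].
have F_proper : ProperFilter (filter_from (nbhs (h%:~R : K))
    (fun U => [set m : nat | U m%:R])).
  apply: filter_from_proper => U /nbhs_ballP[e /= e0 eU].
  have [N _ /(_ N (leqnn N)) /= Ne] :
      \forall N \near \oo, p%:R^-1 ^+ N < e.
    by apply: expr_eventually_lt => //; rewrite invr_ge0 ler0n invp_lt1.
  (* Adding [p ^ N * |h|] makes [h] nonnegative and moves it by at most [p^-N]; naturals thus
     approach [h], and the filter is proper. *)
  have [m mE] : exists m : nat, m%:Z = h + (p ^ N)%:Z * `|h|%N%:Z.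
    have pN : (0 < p ^ N)%N by rewrite expn_gt0 prime_gt0.
    exists `|(h + (p ^ N)%:Z * `|h|%N%:Z)%R|%N; nia.
  exists m; apply: eU; rewrite ball_vabs /= [m%:R]pmulrn mE.
  rewrite intrD opprD addNKr vabsN -PoszM -pmulrn.
  by apply: le_lt_trans Ne; apply: vabs_dvdn_le; rewrite dvdn_mulr.
apply: cvg_lim; first exact: vabs_hausdorff.
apply/cvg_vabsP => e e0; have [N aN] := pow_cvg1_dvdn ca e0.
have a1 := pow_cvg1_vabs ca; have a0 := pow_cvg1_neq0 ca.
have aX1 (k : int) : vabs (a ^ k) = 1 :> R.
  by apply/pow_cvg1_vabs/pow_cvg1Xz.
exists (ball (h%:~R : K) (p%:R^-1 ^+ N)).
  by apply: nbhsx_ballx; rewrite exprn_gt0 // invr_gt0 ltr0n prime_gt0.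
move=> m; rewrite ball_vabs /= [m%:R]pmulrn -intrB => hm.
(* Divisibility is available for naturals only, so the larger exponent is written as the smaller
   plus [k]. *)
have [k [kE|kE]] : exists k : nat, h = m%:Z + k%:Z \/ m%:Z = h + k%:Z.
  by exists `|h - m%:Z|%N; lia.
- move: hm; rewrite kE addrC addKr -pmulrn => /vabs_lt_dvdn /aN.
  apply: le_lt_trans; rewrite -[a ^+ m]/(a ^ m%:Z) expfzDr // vabs_distC.
  by rewrite -[X in _ - X]mulr1 -mulrBr vabsM (aX1 m) mul1r.
- move: hm; rewrite kE opprD addNKr mulrNz vabsN -pmulrn => /vabs_lt_dvdn /aN.
  apply: le_lt_trans; rewrite -[a ^+ m]/(a ^ m%:Z) kE expfzDr //.
  by rewrite -[X in _ - X]mulr1 -mulrBr vabsM (aX1 h) mul1r.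
Qed.

Lemma padic_pow_nat a n : pow_cvg1 a -> padic_pow a n%:R = a ^+ n.
Proof. by move=> ca; rewrite pmulrn padic_pow_int. Qed.

(** The geometric sum fits both branches of [qnum], which spares the integrand a separate case
    [q = 1]. *)
Lemma qnum_nat q n : pow_cvg1 q -> qnum q n%:R = \sum_(i < n) q ^+ i.
Proof.
move=> cq; rewrite /qnum padic_pow_nat //; case: eqVneq => [->|q1].
  by under eq_bigr do rewrite expr1n; rewrite sumr_const card_ord.
rewrite -opprB subrX1 -[1 - q]opprB mulNr invrN mulrN opprK mulrC mulKf //.
by rewrite subr_eq0.
Qed.

(** Uniform continuity for the p-adic topology on naturals; the bound by 1 makes the class stable
    under products. *)
Definition padic_unif (g : nat -> K) :=
  (forall m, vabs (g m) <= 1 :> R) /\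
  forall e, 0 < e ->
    exists N, forall m d, (p ^ N %| d)%N -> vabs (g (m + d)%N - g m) < e.

Lemma padic_unifM f g :
  padic_unif f -> padic_unif g -> padic_unif (fun m => f m * g m).
Proof.
move=> [f1 fu] [g1 gu]; split=> [m|e e0].
  by rewrite vabsM mulr_ile1 ?vabs_ge0.
have [N1 fN] := fu e e0; have [N2 gN] := gu e e0.
exists (maxn N1 N2) => m d dN.
have fd := fN m d (dvdn_trans (dvdn_exp2l p (leq_maxl _ _)) dN).
have gd := gN m d (dvdn_trans (dvdn_exp2l p (leq_maxr _ _)) dN).
have -> : f (m + d)%N * g (m + d)%N - f m * g m =
  f (m + d)%N * (g (m + d)%N - g m) + (f (m + d)%N - f m) * g m by ring.
apply: vabsD_lt; rewrite vabsM.
  apply: le_lt_trans gd; rewrite -[leRHS]mul1r.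
  by rewrite ler_wpM2r ?vabs_ge0.
apply: le_lt_trans fd; rewrite -[leRHS]mulr1.
by rewrite ler_wpM2l ?vabs_ge0.
Qed.

Lemma padic_unifX g n : padic_unif g -> padic_unif (fun m => g m ^+ n).
Proof.
move=> gu; elim: n => [|n IH]; last first.
  by under eq_fun do rewrite exprS; exact: padic_unifM.
by split=> [m|e e0]; [|exists 0 => m d _]; rewrite !expr0 ?vabs1 // subrr vabs0.
Qed.

Lemma padic_unif_pow a : pow_cvg1 a -> padic_unif (fun m => a ^+ m).
Proof.
move=> ca; have a1 := pow_cvg1_vabs ca.
split=> [m|e /(pow_cvg1_dvdn ca)[N aN]]; first by rewrite vabsX a1 expr1n.
exists N => m d /aN; rewrite exprD -[X in _ * _ - X]mulr1 -mulrBr vabsM.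
by rewrite vabsX a1 expr1n mul1r.
Qed.

(** For [q = 1] the sum is [d] itself; otherwise it is [(q ^+ d - 1) / (q - 1)], whence the
    tolerance [e * vabs (q - 1)]. *)
Lemma qsum_dvdn q e : pow_cvg1 q -> 0 < e ->
  exists N, forall d, (p ^ N %| d)%N -> vabs (\sum_(i < d) q ^+ i) < e.
Proof.
move=> cq e0; have [->|q1] := eqVneq q 1.
  have [N _ /(_ N (leqnn N)) /= Ne] :
      \forall N \near \oo, p%:R^-1 ^+ N < e.
    by apply: expr_eventually_lt => //; rewrite invr_ge0 ler0n invp_lt1.
  exists N => d /vabs_dvdn_le dN; apply: le_lt_trans Ne.
  by under eq_bigr do rewrite expr1n; rewrite sumr_const card_ord.
have v0 : 0 < vabs (q - 1) :> R.
  rewrite lt_def vabs_ge0 andbT -subr_eq0 in q1 *.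
  by apply: contra_neq q1 => /vabs_eq0.
have [N qN] := pow_cvg1_dvdn cq (mulr_gt0 e0 v0).
exists N => d /qN; rewrite subrX1 vabsM mulrC.
by rewrite ltr_pM2r.
Qed.

Lemma qsumD q m d :
  \sum_(i < m + d) q ^+ i = \sum_(i < m) q ^+ i + q ^+ m * \sum_(i < d) q ^+ i.
Proof.
rewrite big_split_ord /= mulr_sumr; congr (_ + _).
by apply: eq_bigr => i _; rewrite exprD.
Qed.

Lemma padic_unif_qsum q k : pow_cvg1 q ->
  padic_unif (fun m => \sum_(i < k + m) q ^+ i).
Proof.
move=> cq; have q1 := pow_cvg1_vabs cq.
split=> [m|e /(qsum_dvdn cq)[N qN]].
  by apply: vabs_sum_le => // i _; rewrite vabsX q1 expr1n.
exists N => m d /qN; rewrite addnA qsumD addrC addKr vabsM vabsX q1.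
by rewrite expr1n mul1r.
Qed.

(** * Alternating sums for odd [p] *)

Hypothesis p_odd : odd p.

Lemma two_neq0 : 2%:R != 0 :> K.
Proof.
apply: contra_eq_neq (vabs_coprime (n := 2) _) => [-> /=|].
  by rewrite vabs0 eq_sym oner_eq0.
by rewrite coprimen2.
Qed.

(** For [a = -1] the odd powers [a ^+ (p ^ N)] stay at -1, and their limit 1 would force [2 = 0]. *)
Lemma pow_cvg1_1D_neq0 a : pow_cvg1 a -> 1 + a != 0.
Proof.
move=> /cvg_vabsP ca; apply: contra_neq two_neq0 => /eqP.
rewrite addrC addr_eq0 => /eqP aE; apply: (@vabs_eq0 R).
apply/eqP; rewrite eq_le vabs_ge0 andbT; apply/ler_addgt0Pl => e /ca[N _].
move=> /(_ N (leqnn N)) /=; rewrite aE -signr_odd oddX p_odd orbT expr1.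
by rewrite -opprD vabsN addr0 => /ltW.
Qed.

Lemma alternating_sum_cvg g : padic_unif g ->
  cvg ((fun N => \sum_(0 <= y < p ^ N) (-1) ^+ y * g y) @ \oo).
Proof.
move=> [_ gu]; apply: vabs_cauchy_cvg => e e0.
have [N0 gN] := gu e e0; exists N0 => // N /= N0N.
(* Grouping by blocks of length [p ^ N], each block carries the sign of its
   index since p is odd, and these p signs add up to 1. *)
have sign_block i : (-1) ^+ (i * p ^ N) = (-1) ^+ i :> K.
  by rewrite -signr_odd oddM oddX p_odd orbT andbT signr_odd.
have sum_sign : \sum_(0 <= i < p) (-1) ^+ i = 1 :> K.
  rewrite big_mkord; apply: (@mulfI _ (-1 - 1)).
    by rewrite -opprD oppr_eq0 two_neq0.
  by rewrite -subrX1 -signr_odd p_odd mulr1.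
(* The shorter sum, multiplied by 1 written as the sum of signs, is matched block by block with the
   longer one; what remains are differences [g (j + i * p ^ N) - g j]. *)
rewrite expnS big_nat_mul -[X in _ - X]mul1r -[X in X * _]sum_sign mulr_suml -sumrB.
apply: vabs_sum_lt => // i _.
rewrite -{1}[(i * _)%N]add0n big_addn mulSn addnK mulr_sumr -sumrB.
apply: vabs_sum_lt => // j _.
rewrite exprD sign_block mulrA [_ ^+ i * _]mulrC -mulrBr !vabsM !vabsX vabsN.
rewrite vabs1 !expr1n !mul1r; apply: gN.
by rewrite dvdn_mull // dvdn_exp2l.
Qed.

Lemma Euler_poly_nat h n q zeta k : pow_cvg1 q -> pow_cvg1 zeta ->
  Euler_poly h n q zeta k%:R =
  lim ((fun N => (1 + q) / (1 + q ^+ (p ^ N)) *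
         \sum_(0 <= y < p ^ N) (-1) ^+ y *
           ((q ^ h * zeta) ^+ y * (\sum_(i < k + y) q ^+ i) ^+ n)) @ \oo).
Proof.
move=> cq cz; rewrite /Euler_poly /fermionic_integral.
suff E (N : nat) : \sum_(0 <= x < p ^ N) qnum q (k%:R + x%:R) ^+ n *
    padic_pow zeta x%:R * padic_pow q ((h - 1)%:~R * x%:R) * (- q) ^+ x =
  \sum_(0 <= y < p ^ N) (-1) ^+ y *
    ((q ^ h * zeta) ^+ y * (\sum_(i < k + y) q ^+ i) ^+ n).
  by under eq_fun do rewrite E.
apply: eq_bigr => y _.
rewrite -natrD qnum_nat // padic_pow_nat // [y%:R]pmulrn -intrM padic_pow_int //.
rewrite [(- q) ^+ y]exprNn exprMn.
(* The factor [q ^+ y] of [(- q) ^+ y] raises the weight from [h - 1] to [h]. *)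
have -> : (q ^ h) ^+ y = q ^ ((h - 1) * y%:Z) * q ^+ y.
  rewrite -[q ^+ y]/(q ^ y%:Z) -expfzDr ?pow_cvg1_neq0 //.
  by rewrite -[LHS]/((q ^ h) ^ y%:Z) exprz_exp; congr (_ ^ _); ring.
ring.
Qed.

(** A shift by two keeps the sign, and [a ^+ 2] completes the weight; terms [n] and [n + 1] enter,
    terms 0 and 1 leave. *)
Lemma alternating_sum_shift2 a (g : nat -> K) n :
  a ^+ 2 * \sum_(0 <= y < n) (-1) ^+ y * (a ^+ y * g y.+2) =
  \sum_(0 <= y < n) (-1) ^+ y * (a ^+ y * g y) +
  ((-1) ^+ n * (a ^+ n * g n) + (-1) ^+ n.+1 * (a ^+ n.+1 * g n.+1)
   - g 0%N + a * g 1%N).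
Proof.
elim: n => [|n IH]; first by rewrite !big_geq // !expr0 !expr1; ring.
rewrite !big_nat_recr //= mulrDr IH !exprS; ring.
Qed.

(** Since [0 < n], the term at [p ^ N] tends to 0 and the one at 0 vanishes; those at [p ^ N + 1],
    an even index, and at 1 contribute [a] each. *)
Lemma Euler_sum_shift2_cvg a q n : pow_cvg1 a -> pow_cvg1 q -> (0 < n)%N ->
  (fun N => (-1) ^+ (p ^ N) * (a ^+ (p ^ N) * (\sum_(i < p ^ N) q ^+ i) ^+ n)
    + (-1) ^+ (p ^ N).+1 *
      (a ^+ (p ^ N).+1 * (\sum_(i < (p ^ N).+1) q ^+ i) ^+ n)
    - (\sum_(i < 0) q ^+ i) ^+ n + a * (\sum_(i < 1) q ^+ i) ^+ n) @ \oo -->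
  2%:R * a.
Proof.
move=> ca cq n0.
have G0 : (fun N => \sum_(i < p ^ N) q ^+ i) @ \oo --> (0 : K).
  apply/cvg_vabsP => e /(qsum_dvdn cq)[N0 GN]; exists N0 => // N /= N0N.
  by rewrite subr0; apply: GN; exact: dvdn_exp2l.
have sgn N : (-1) ^+ (p ^ N) = -1 :> K.
  by rewrite -signr_odd oddX p_odd orbT.
have GS m : \sum_(i < m.+1) q ^+ i = 1 + q * \sum_(i < m) q ^+ i.
  by rewrite -add1n qsumD big_ord1 expr0 expr1.
have -> : 2%:R * a = - 1 * (1 * 0 ^+ n) + 1 * ((a * 1) * (1 + q * 0) ^+ n) + a.
  by rewrite expr0n eqn0Ngt n0 /= !mulr0 addr0 expr1n; ring.
under eq_fun => N.
  rewrite exprS sgn mulrNN mulr1 big_ord0 expr0n eqn0Ngt n0 subr0.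
  rewrite big_ord1 expr0 expr1n mulr1 exprS GS; over.
apply: cvg_vabsD; last exact: cvg_cst.
apply: cvg_vabsD; (apply: cvg_vabsM; first exact: cvg_cst).
  by apply: cvg_vabsM => //; exact: cvg_vabsX.
apply: cvg_vabsM; first by apply: cvg_vabsM => //; exact: cvg_cst.
apply: cvg_vabsX; apply: cvg_vabsD; first exact: cvg_cst.
by apply: cvg_vabsM => //; exact: cvg_cst.
Qed.

End PadicPowers.

(** * Passage to the limit in the shift identity *)

Theorem theorem4 (R : realType) (p : nat) (p_prime : prime p) (p_odd : odd p)
    (K : padicComplexType R p) (q : K) (hq : vabs (q - 1) < 1 :> R)
    (h : int) (zeta : K) (hzeta : Tp K zeta) (n : nat) (hn : (1 <= n)%N) :
  q ^ (2 * h) * zeta ^+ 2 * Euler_poly h n q zeta 2%:R =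
    Euler_number h n q zeta
    + (1 + q) / (1 + q ^ h * zeta) * q ^ (2 * h) * zeta ^+ 2
    + (1 + q) / (1 + q ^ h * zeta) * q ^ h * zeta.
Proof.
have cq := pow_cvg1_near1 p_prime hq; have cz := pow_cvg1_Tp hzeta.
rewrite /Euler_number -[0]/(0%:R) !Euler_poly_nat //.
have ca : pow_cvg1 (q ^ h * zeta) by apply: pow_cvg1M => //; exact: pow_cvg1Xz.
set a := q ^ h * zeta in ca *.
have n2 := two_neq0 (K := K) p_prime p_odd.
have a1 : 1 + a != 0 := pow_cvg1_1D_neq0 p_prime p_odd ca.
pose c N := (1 + q) / (1 + q ^+ (p ^ N)).
pose S k N : K := \sum_(0 <= y < p ^ N)
  (-1) ^+ y * (a ^+ y * (\sum_(i < k + y) q ^+ i) ^+ n).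
have cc : c @ \oo --> (1 + q) / 2%:R.
  apply: cvg_vabsM; first exact: cvg_cst.
  by apply: cvg_vabsV => //; apply: cvg_vabsD => //; exact: cvg_cst.
have cS k : S k @ \oo --> lim (S k @ \oo).
  apply: alternating_sum_cvg => //; apply: padic_unifM.
    exact: padic_unif_pow.
  by apply: padic_unifX; exact: padic_unif_qsum.
have limE k : lim ((fun N => c N * S k N) @ \oo) =
    (1 + q) / 2%:R * lim (S k @ \oo).
  apply: cvg_lim; first exact: vabs_hausdorff.
  exact: cvg_vabsM.
have shift : a ^+ 2 * lim (S 2%N @ \oo) = lim (S 0%N @ \oo) + 2%:R * a.
  (* Both sides are limits of [a ^+ 2 * S 2 N]: directly, and after rewriting it by the shift
     identity. *)
  apply: (cvg_unique vabs_hausdorff (F := (fun N => a ^+ 2 * S 2%N N) @ \oo)).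
    by apply: cvg_vabsM => //; exact: cvg_cst.
  rewrite (funext (fun N => alternating_sum_shift2 a
    (fun y => (\sum_(i < y) q ^+ i) ^+ n) (p ^ N)) : (fun N => a ^+ 2 * S 2%N N) = _).
  by apply: cvg_vabsD; [exact: cS|exact: Euler_sum_shift2_cvg].
rewrite (limE 2%N) (limE 0%N).
have -> : q ^ (2 * h) = (q ^ h) ^+ 2.
  by rewrite mulrC -exprz_exp.
rewrite -exprMn mulrCA shift.
rewrite -[_ * zeta ^+ 2]mulrA -exprMn -[_ * zeta]mulrA -/a.
by field; rewrite n2 a1.
Qed.
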